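(* Let $d\in\mathbb{N}$, $h>0$, $\delta>0$. For any $\boldsymbol k\in\mathbb{N}_0^d$ (and every $\hat{\boldsymbol x}\in\mathbb{S}^{d-1}$), we have $$\hat f_{\boldsymbol k}(r,\hat{\boldsymbol x})\big|_{r=0}=\partial_r\hat f_{\boldsymbol k}(r,\hat{\boldsymbol x})\big|_{r=0}=0.$$ Moreover, if $|\boldsymbol k|_\infty\ge\delta/h+2$, then $$\hat f_{\boldsymbol k}(r,\hat{\boldsymbol x})=0\quad\text{for all }(r,\hat{\boldsymbol x})\in(0,\delta]\times\mathbb{S}^{d-1}.$$
   Context: $\mathbb{N}_0$ is the set of nonnegative integers, $\mathbb{S}^{d-1}$ is the unit sphere in $\mathbb{R}^d$, and $|\boldsymbol k|_\infty=\max_{1\le j\le d}k_j$. For $\boldsymbol k\in\mathbb{N}_0^d$ and $\boldsymbol s\in\mathbb{R}^d$, $$f_{\boldsymbol k}(\boldsymbol s)=2\prod_{j=1}^d B_3(k_j+2)-\prod_{j=1}^d B_3(k_j+2-s_j/h)-\prod_{j=1}^d B_3(k_j+2+s_j/h),$$ and $\hat f_{\boldsymbol k}(r,\hat{\boldsymbol x})=f_{\boldsymbol k}(r\hat{\boldsymbol x})$ is $f_{\boldsymbol k}$ expressed in spherical coordinates ($r=|\boldsymbol s|$, $\hat{\boldsymbol x}\in\mathbb{S}^{d-1}$). The cubic B-spline is $B_3(t)=t^3/6$ on $[0,1)$; $-t^3/2+2t^2-2t+2/3$ on $[1,2)$; $t^3/2-4t^2+10t-22/3$ on $[2,3)$;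 $-(t-4)^3/6$ on $[3,4)$; $0$ elsewhere. *)

(* Defs.v *)
From HB Require Import structures.
From mathcomp Require Import all_boot all_order all_algebra.
From mathcomp Require Import all_classical all_reals all_analysis.
Import Order.TTheory GRing.Theory Num.Theory.
Import numFieldNormedType.Exports.

Set Implicit Arguments.
Unset Strict Implicit.
Unset Printing Implicit Defensive.

Local Open Scope classical_set_scope.
Local Open Scope ring_scope.

Definition B3 (R : realType) (t : R) : R :=
  if 0 <= t < 1 then t ^+ 3 / 6
  else if 1 <= t < 2 then - (t ^+ 3 / 2) + 2 * t ^+ 2 - 2 * t + 2 / 3
  else if 2 <= t < 3 then t ^+ 3 / 2 - 4 * t ^+ 2 + 10 * t - 22 / 3
  else if 3 <= t < 4 then - ((t - 4) ^+ 3 / 6)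
  else 0.

(* The library norm `|x| on 'rV_d is the maximum norm, hence this one. *)
Definition enorm (R : realType) (d : nat) (x : 'rV[R]_d) : R :=
  Num.sqrt (\sum_(j < d) x 0 j ^+ 2).

Definition usphere (R : realType) (d : nat) : set 'rV[R]_d :=
  [set x | enorm x = 1].
Arguments usphere : clear implicits.

Definition supnorm (d : nat) (k : 'I_d -> nat) : nat := \max_(j < d) k j.

Definition fk (R : realType) (d : nat) (h : R) (k : 'I_d -> nat)
    (s : 'rV[R]_d) : R :=
  2 * \prod_(j < d) B3 ((k j)%:R + 2)
  - \prod_(j < d) B3 ((k j)%:R + 2 - s 0 j / h)
  - \prod_(j < d) B3 ((k j)%:R + 2 + s 0 j / h).

(* The formula makes sense for every real r, so that the radial derivative
   at r = 0 is an ordinary two-sided derivative. *)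
Definition fhat (R : realType) (d : nat) (h : R) (k : 'I_d -> nat)
    (r : R) (x : 'rV[R]_d) : R :=
  fk h k (r *: x).

(* Main.v *)
Require Import Defs.
From HB Require Import structures.
From mathcomp Require Import all_boot all_order all_algebra.
From mathcomp Require Import all_classical all_reals all_analysis.
From mathcomp Require Import ring lra.
Import Order.TTheory GRing.Theory Num.Theory.
Import numFieldNormedType.Exports.

Set Implicit Arguments.
Unset Strict Implicit.
Unset Printing Implicit Defensive.

Local Open Scope classical_set_scope.
Local Open Scope ring_scope.

(** Why the statement holds.  Put
      g r = \prod_j B3 (k_j + 2 + r * x_j / h),
    so that fhat h k r x = 2 * g 0 - g (- r) - g r.  This vanishes at r = 0,
    and it is an even function of r; so as soon as g is differentiable at 0,
    the derivative of fhat at 0 is g'(0) - g'(0) = 0.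

    The only analytic input is thus the differentiability of the cubic spline
    at the integers n + 2.  For n <= 2 these are knots, where two cubic pieces
    meet; since the spline is twice continuously differentiable, both pieces
    stay within O(u ^ 2) of the same tangent line at distance u from the knot
    ([B3_tangent_line]), and such a two-sided bound gives differentiability
    ([is_derive_quadratic_error]) without gluing one-sided derivatives.  For
    n > 2 the spline vanishes around n + 2.

    For the second part, a coordinate of a unit vector is at most 1 in absolute
    value, so for r <= delta the arguments k_j + 2 -+ r * x_j / h stay at
    distance at most delta / h from k_j + 2.  For the index j at which k_j is
    maximal they are therefore at least 4, beyond the support of B3, and each
    of the three products has a zero factor. *)

(** * Differentiability at a point and even functions *)

(** The difference quotient at a is within C * |u| of b, hence tends to b.
    Being two-sided, the criterion suits functions defined piecewise around
    a. *)
Lemma is_derive_quadratic_error (R : realType) (f : R -> R) (a b C : R) :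
  (forall u, `|u| < 1 -> `|f (a + u) - f a - b * u| <= C * u ^+ 2) ->
  is_derive a (1 : R) f b.
Proof.
move=> f_approx.
(* The bound at any nonzero u, here 1 / 2, forces the sign of C. *)
have C_ge0 : 0 <= C.
  have half_lt1 : `|2^-1 : R| < 1 by rewrite ger0_norm; lra.
  by have := le_trans (normr_ge0 _) (f_approx _ half_lt1); nra.
have quotient_cvg :
    (fun u : R => u^-1 *: ((f \o shift a) (u *: (1 : R)) - f a)) @ 0^' --> b.
  apply/cvgrPdist_le => e e_gt0.
  have eC_gt0 : 0 < e / (C + 1) by rewrite divr_gt0// ltr_wpDl.
  near=> u.
  have u_neq0 : u != 0 by near: u; exact: nbhs_dnbhs_neq.
  have u_lt1 : `|u| < 1 by near: u; apply: dnbhs0_lt.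
  (* C + 1 rather than C keeps the radius meaningful when C = 0. *)
  have u_small : `|u| < e / (C + 1) by near: u; apply: dnbhs0_lt.
  have u_gt0 : 0 < `|u| by rewrite normr_gt0.
  rewrite /= -[u *: 1]/(u * 1) mulr1 (addrC u) -[u^-1 *: _]/(u^-1 * _).
  have -> : b - u^-1 * (f (a + u) - f a)
      = - (u^-1 * (f (a + u) - f a - b * u)) by field.
  rewrite normrN normrM normfV mulrC ler_pdivrMr//.
  apply: le_trans (f_approx u u_lt1) _.
  rewrite -real_normK ?num_real// expr2 mulrA ler_wpM2r//.
  by move: u_small; rewrite ltr_pdivlMr ?ltr_wpDl// => ?; nra.
by split; [exact: cvgP quotient_cvg | exact: cvg_lim quotient_cvg].
Unshelve. all: by end_near. Qed.

(** The terms g r and g (- r) contribute opposite derivatives at 0, whatever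
    g'(0) is. *)
Lemma is_derive_even_part (R : realType) (c : R) (g : R -> R) :
  derivable g 0 1 -> is_derive (0 : R) (1 : R) (fun r => c - g (- r) - g r) 0.
Proof.
move=> /derivableP dg.
have dgN : is_derive (0 : R) (1 : R) (g \o -%R) (- 1 * 'D_1 g 0).
  by rewrite mulrC; apply: is_derive1_comp; rewrite oppr0.
have -> : (fun r => c - g (- r) - g r) = (cst c - (g \o -%R)) - g by [].
by apply: is_derive_eq; rewrite sub0r mulN1r opprK subrr.
Qed.

Lemma derivable_prod_seq (R : realType) (I : Type) (s : seq I)
    (g : I -> R -> R) (a : R) :
  (forall i, derivable (g i) a 1) ->
  derivable (fun r => \prod_(i <- s) g i r) a 1.
Proof.
move=> dg; elim: s => [|i s IHs].
  by under eq_fun do rewrite big_nil; exact: derivable_cst.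
by under eq_fun do rewrite big_cons; exact: derivableM.
Qed.

(** * The cubic B-spline *)

Lemma B3_eq0 (R : realType) (t : R) : 4 <= t -> B3 t = 0.
Proof. by move=> t_ge4; rewrite /B3 !ifF//; apply/negP => /andP[]; lra. Qed.

(** With t = n + 2 + u, the deviation from the tangent line is
    - u ^ 2 + |u| ^ 3 / 2 at the knot 2, is u ^ 2 / 2 plus u ^ 3 / 2 (left) or
    - u ^ 3 / 6 (right) at the knot 3, is at most |u| ^ 3 / 6 at the knot 4,
    and is 0 further on; for |u| < 1 all of these are at most u ^ 2 in absolute
    value.  The slopes are 0, - 1 / 2, 0 and 0. *)
Lemma B3_tangent_line (R : realType) (n : nat) : exists b : R,
  forall u : R, `|u| < 1 ->
    `|B3 (n%:R + 2 + u) - B3 (n%:R + 2) - b * u| <= u ^+ 2.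
Proof.
have piece2 (t : R) : 1 <= t < 2 ->
    B3 t = - (t ^+ 3 / 2) + 2 * t ^+ 2 - 2 * t + 2 / 3.
  by move=> t12; rewrite /B3 ifF ?t12//; apply/negP => /andP[]; lra.
have piece3 (t : R) : 2 <= t < 3 ->
    B3 t = t ^+ 3 / 2 - 4 * t ^+ 2 + 10 * t - 22 / 3.
  by move=> t23; rewrite /B3 2?ifF ?t23//; apply/negP => /andP[]; lra.
have piece4 (t : R) : 3 <= t < 4 -> B3 t = - ((t - 4) ^+ 3 / 6).
  by move=> t34; rewrite /B3 3?ifF ?t34//; apply/negP => /andP[]; lra.
case: n => [|[|[|n]]].
- exists 0 => u; rewrite ltr_norml ler_norml => /andP[u_gtN1 u_lt1].
  rewrite (piece3 (0%:R + 2)); last lra.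
  have [u_ge0|u_lt0] := leP 0 u.
    by rewrite piece3; [apply/andP; split; nra | lra].
  by rewrite piece2; [apply/andP; split; nra | lra].
- exists (- 2^-1) => u; rewrite ltr_norml ler_norml => /andP[u_gtN1 u_lt1].
  rewrite (piece4 (1%:R + 2)); last lra.
  have [u_ge0|u_lt0] := leP 0 u.
    by rewrite piece4; [apply/andP; split; nra | lra].
  by rewrite piece3; [apply/andP; split; nra | lra].
- exists 0 => u; rewrite ltr_norml ler_norml => /andP[u_gtN1 u_lt1].
  rewrite (B3_eq0 (t := 2%:R + 2)); last lra.
  have [u_ge0|u_lt0] := leP 0 u.
    by rewrite B3_eq0; [apply/andP; split; nra | lra].
  by rewrite piece4; [apply/andP; split; nra | lra].
- exists 0 => u; rewrite ltr_norml => /andP[u_gtN1 u_lt1].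
  have n_ge3 : 3 <= n.+3%:R :> R by rewrite ler_nat.
  by rewrite !B3_eq0 ?mul0r ?subrr ?normr0 ?sqr_ge0//; lra.
Qed.

Lemma derivable_B3_nat (R : realType) (n : nat) :
  derivable (@B3 R) (n%:R + 2) 1.
Proof.
have [b B3_approx] := B3_tangent_line R n.
suff : is_derive (n%:R + 2 : R) (1 : R) (@B3 R) b by move=> [].
apply: (@is_derive_quadratic_error _ _ _ _ 1) => u u_lt1.
by rewrite mul1r; exact: B3_approx.
Qed.

Lemma derivable_B3_line (R : realType) (n : nat) (c : R) :
  derivable (fun r : R => B3 (n%:R + 2 + r * c)) (0 : R) 1.
Proof.
have dline : is_derive (0 : R) (1 : R) (fun r : R => n%:R + 2 + r * c) c.
  (* An affine function meets the quadratic bound with constant 0. *)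
  apply: (@is_derive_quadratic_error _ _ _ _ 0) => u _.
  by rewrite !mul0r normr_le0; apply/eqP; ring.
have dB3 : is_derive (n%:R + 2 + 0 * c) (1 : R) (@B3 R)
    ('D_1 (@B3 R) (n%:R + 2)).
  by rewrite mul0r addr0; apply: derivableP; exact: derivable_B3_nat.
by have [] := @is_derive1_comp _ (@B3 R) (fun r => n%:R + 2 + r * c) _ _ _ dB3 dline.
Qed.

(** * The second difference of the tensor-product spline *)

Lemma fhat_even_part (R : realType) (d : nat) (h : R) (k : 'I_d -> nat)
    (r : R) (x : 'rV[R]_d) (g := fun r : R =>
      \prod_(j < d) B3 ((k j)%:R + 2 + r * (x 0 j / h))) :
  fhat h k r x = 2 * g 0 - g (- r) - g r.
Proof.
rewrite /fhat /fk /g; congr (2 * _ - _ - _); apply: eq_bigr => j _.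
- by rewrite mul0r addr0.
- by rewrite mxE mulNr mulrA.
- by rewrite mxE mulrA.
Qed.

Lemma usphere_coord_le1 (R : realType) (d : nat) (x : 'rV[R]_d) (j : 'I_d) :
  usphere R d x -> `|x 0 j| <= 1.
Proof.
rewrite /usphere /= /enorm => x_unit.
rewrite -x_unit -sqrtr_sqr; apply: ler_wsqrtr.
by rewrite (bigD1 j)//= lerDl sumr_ge0// => i _; exact: sqr_ge0.
Qed.

Lemma prod_B3_eq0 (R : realType) (d : nat) (t : 'I_d -> R) (j : 'I_d) :
  4 <= t j -> \prod_(i < d) B3 (t i) = 0.
Proof. by move=> tj_ge4; rewrite (bigD1 j)//= B3_eq0 ?mul0r. Qed.

Theorem proposition3p1 (R : realType) (d : nat) (hd : (0 < d)%N)
    (h delta : R) (h_gt0 : 0 < h) (delta_gt0 : 0 < delta)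
    (k : 'I_d -> nat) :
  (forall x : 'rV[R]_d, usphere R d x ->
     fhat h k 0 x = 0 /\
     is_derive (0 : R) (1 : R) (fun r : R => fhat h k r x) (0 : R)) /\
  (delta / h + 2 <= (supnorm k)%:R ->
   forall (r : R) (x : 'rV[R]_d), 0 < r <= delta -> usphere R d x ->
     fhat h k r x = 0).
Proof.
split=> [x _|k_large r x /andP[r_gt0 r_le] x_unit].
  split; first by rewrite fhat_even_part oppr0; ring.
  under eq_fun do rewrite fhat_even_part.
  apply: is_derive_even_part; apply: derivable_prod_seq => j.
  exact: derivable_B3_line.
(* The products vanish through a factor at which k is maximal. *)
have [j kj_max] : {j | supnorm k = k j}.
  by apply: bigop.eq_bigmax; rewrite card_ord.
have shift_le : `|r * x 0 j / h| <= delta / h.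
  rewrite normrM normfV (gtr0_norm h_gt0) ler_wpM2r ?invr_ge0 ?(ltW h_gt0)//.
  rewrite normrM (gtr0_norm r_gt0) -[delta]mulr1.
  by apply: ler_pM => //; [exact: ltW | exact: usphere_coord_le1].
have dh_ge0 : 0 <= delta / h by rewrite divr_ge0 ?ltW.
move: k_large shift_le; rewrite kj_max ler_norml => k_large /andP[lo hi].
rewrite /fhat /fk !(prod_B3_eq0 (j := j)) ?mxE ?mulr0 ?subrr//; lra.
Qed.
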